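(* Let $\Sigma=(\mathbb X,\mathbb X_0,\mathbb X_s,P,\mathbb W,F,\mathbb Y,h)$ be an infinite, deterministic discrete-time switched system with dwell time $k_d\in\mathbb N_{\ge1}$, where $\mathbb X,\mathbb W$ are finite unions of boxes and $h$ satisfies $\|h(x)-h(y)\|\le\ell(\|x-y\|)$ for all $x,y\in\mathbb X$ for some $\ell\in\mathcal K_\infty$, and let $T(\Sigma)=(X,X_0,X_s,U,W,\mathcal F,Y,\mathcal H)$ be its associated transition system. Suppose that for every $p\in P$ the system $\Sigma_p$ is $\delta$-ISS, with function $V_p$, functions $\underline\alpha_p,\overline\alpha_p,\rho_p\in\mathcal K_\infty$ and constant $0<\kappa_p<1$. Suppose moreover that: (i) there exists $\mu\ge1$ such that $V_p(x,y)\le\mu V_q(x,y)$ for all $x,y\in\mathbb X$ and all $p,q\in P$; (ii) for every $p\in P$ there exists $\gamma_p\in\mathcal K_\infty$ such that $V_p(x,y)\le V_p(x,z)+\gamma_p(\|y-z\|)$ for all $x,y,z\in\mathbb X$. Let $\epsilon>1$. For any design parameters $\varepsilon,\vartheta\in\mathbb R_{\ge0}$, let $T(\hat\Sigma)$ be the finite abstraction of $T(\Sigma)$ (constructed as described in the context) with any state set quantization parameter $\eta$ satisfying $$\eta\le\min\{\hat\gamma^{-1}((1-\kappa)\varepsilon-\rho(\vartheta)),\ \overline\alpha^{-1}(\varepsilon)\},$$ where $$\kappa=\max_{p\in P}\kappa_p^{\frac{\epsilon-1}{\epsilon}},\quad \rho=\max_{p\in P}\kappa_p^{-\frac{k_d}{\epsilon}}\rho_p,\quad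 \hat\gamma=\max_{p\in P}\kappa_p^{-\frac{k_d}{\epsilon}}\gamma_p,\quad \overline\alpha=\max_{p\in P}\overline\alpha_p$$ (pointwise maxima of functions). If $k_d\ge\epsilon\frac{\ln\mu}{\ln(1/\kappa_p)}+1$ for all $p\in P$, then the function $\mathcal V$ defined by $$\mathcal V((x,p,l),(\hat x,p,l)):=V_p(x,\hat x)\,\kappa_p^{-\frac{l}{\epsilon}}$$ is a local $\varepsilon$-InitSOPSF from $T(\Sigma)$ to $T(\hat\Sigma)$ (with the constant $\vartheta$).
   Context: $\mathcal K_\infty$ is the set of continuous, strictly increasing, unbounded functions $\alpha:\mathbb R_{\ge0}\to\mathbb R_{\ge0}$ with $\alpha(0)=0$. $\|\cdot\|$ is the infinity norm. Quantization. If $S=\bigcup_{j=1}^MS_j\subseteq\mathbb R^n$ is a finite union of boxes $S_j=\prod_{i=1}^n[c_i^j,d_i^j]$ with $c_i^j<d_i^j$, then $\mathrm{span}(S)=\min_j\min_i|d_i^j-c_i^j|$. For $0<\eta\le\mathrm{span}(S)$, $[S]_\eta=\{a\in S\mid a_j=k_j\eta,\ k_j\in\mathbb Z\}$. For a product $S=\prod_iS_i$ and a positive vector $\phi=[\phi_1;\dots;\phi_N]$ with $\phi_i\le\mathrm{span}(S_i)$, $[S]_\phi=\prod_i[S_i]_{\phi_i}$. Switched system. $\Sigma=(\mathbb X,\mathbb X_0,\mathbb X_s,P,\mathbb W,F,\mathbb Y,h)$ consists of a state set $\mathbb X$, initial state set $\mathbb X_0$, secret set $\mathbb X_s$ (subsets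 of $\mathbb R^n$), finite set of modes $P=\{1,\dots,m\}$, internal input set $\mathbb W$ and output set $\mathbb Y$ (subsets of Euclidean spaces), a family $F=\{f_p\}_{p\in P}$ of maps from $\mathbb X\times\mathbb W$ to $\mathbb X$ (set-valued in general; single-valued in the deterministic case considered here), and an output map $h:\mathbb X\to\mathbb Y$. Dynamics: $\mathbf x(k+1)\in f_{\mathsf p(k)}(\mathbf x(k),\omega(k))$, $\mathbf y(k)=h(\mathbf x(k))$, with switching signal $\mathsf p$ having dwell time $k_d$ (consecutive switching instants differ by at least $k_d$). It is infinite if it is not the case that both $\mathbb X$ and $\mathbb W$ are finite. Systems are assumed non-blocking: for each $x$ some $f_p(x,w)$ is nonempty. $\Sigma_p$ denotes $\Sigma$ with constant switching signal $p$. Associated transition system. $T(\Sigma)=(X,X_0,X_s,U,W,\mathcal F,Y,\mathcal H)$ with $X=\mathbb X\times P\times\{0,\dots,k_d-1\}$, $X_0=\mathbb X_0\times P\times\{0\}$, $X_s=\mathbb X_s\times P\times\{0,\dots,k_d-1\}$, $U=P$, $W=\mathbb W$, $Y=\mathbb Y$, $\mathcal H(x,p,l)=h(x)$, and $(x^+,p^+,l^+)\in\mathcal F((x,p,l),u,w)$ iff $x^+=f_p(x,w)$, $u=p$, and one of: ($l<k_d-1$, $p^+=p$, $l^+=l+1$); ($l=k_d-1$, $p^+=p$, $l^+=k_d-1$); ($l=k_d-1$, $p^+\ne p$, $l^+=0$). $\delta$-ISS. $\Sigma_p$ is $\delta$-ISS with $V_p:\mathbb X\times\mathbb X\to\mathbb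 R_{\ge0}$, $\underline\alpha_p,\overline\alpha_p,\rho_p\in\mathcal K_\infty$, $0<\kappa_p<1$, if for all $x,\hat x\in\mathbb X$ and $w,\hat w\in\mathbb W$: $\underline\alpha_p(\|x-\hat x\|)\le V_p(x,\hat x)\le\overline\alpha_p(\|x-\hat x\|)$ and $V_p(f_p(x,w),f_p(\hat x,\hat w))\le\kappa_pV_p(x,\hat x)+\rho_p(\|w-\hat w\|)$. Finite abstraction. $T(\hat\Sigma)=(\hat X,\hat X_0,\hat X_s,\hat U,\hat W,\hat{\mathcal F},\hat Y,\hat{\mathcal H})$ where, for a state quantization parameter $0<\eta\le\min\{\mathrm{span}(\mathbb X_s),\mathrm{span}(\mathbb X\setminus\mathbb X_s)\}$ and an internal input quantization parameter $\phi$ with $0<\|\phi\|\le\mathrm{span}(\mathbb W)$: $\hat X=[\mathbb X]_\eta\times P\times\{0,\dots,k_d-1\}$; $\hat X_0=[\mathbb X_0]_\eta\times P\times\{0\}$; $\hat X_s=[\mathbb X_s]_\eta\times P\times\{0,\dots,k_d-1\}$; $\hat U=P$; $\hat W=[\mathbb W]_\phi$; $(\hat x^+,p^+,l^+)\in\hat{\mathcal F}((\hat x,p,l),\hat u,\hat w)$ iff $\|f_p(\hat x,\hat w)-\hat x^+\|\le\eta$, $\hat u=p$, and one of the three $(p,l)$-scenarios listed for $\mathcal F$ holds; $\hat Y=\{\mathcal H(\hat x,p,l)\mid(\hat x,p,l)\in\hat X\}$; $\hat{\mathcal H}(\hat x,p,l)=h(\hat x)$. Local $\varepsilon$-InitSOPSF.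 A function $\mathcal S:X\times\hat X\to\mathbb R_{\ge0}$ is a local $\varepsilon$-InitSOPSF (local $\varepsilon$-approximate initial-state opacity-preserving simulation function) from $T(\Sigma)$ to $T(\hat\Sigma)$ if there exist a constant $\vartheta\ge0$ and $\alpha\in\mathcal K_\infty$ such that: 1(a) $\forall z^0\in X_0\cap X_s$, $\exists\hat z^0\in\hat X_0\cap\hat X_s$ with $\mathcal S(z^0,\hat z^0)\le\varepsilon$; 1(b) $\forall\hat z^0\in\hat X_0\setminus\hat X_s$, $\exists z^0\in X_0\setminus X_s$ with $\mathcal S(z^0,\hat z^0)\le\varepsilon$; 2. $\forall z\in X,\forall\hat z\in\hat X$: $\alpha(\|\mathcal H(z)-\hat{\mathcal H}(\hat z)\|)\le\mathcal S(z,\hat z)$; 3. for all $z\in X,\hat z\in\hat X$ with $\mathcal S(z,\hat z)\le\varepsilon$ and all $w\in W,\hat w\in\hat W$ with $\|w-\hat w\|\le\vartheta$: (a) $\forall u\in U$, $\forall z^+\in\mathcal F(z,u,w)$, $\exists\hat u\in\hat U$, $\exists\hat z^+\in\hat{\mathcal F}(\hat z,\hat u,\hat w)$ with $\mathcal S(z^+,\hat z^+)\le\varepsilon$; (b) $\forall\hat u\in\hat U$, $\forall\hat z^+\in\hat{\mathcal F}(\hat z,\hat u,\hat w)$, $\exists u\in U$, $\exists z^+\in\mathcal F(z,u,w)$ with $\mathcal S(z^+,\hat z^+)\le\varepsilon$. The function $\mathcal V$ in the claim is defined only on pairs $((x,p,l),(\hat x,p,l))$ sharing the same $(p,l)$;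 conditions 1-3 for $\mathcal V$ are understood over such pairs only (the pairs asserted to exist must also be of this form).
   Formalization: The formal theorem also assumes that X_0 ∩ X_s is a finite union of boxes with η at most its span; otherwise it may contain no grid point and condition 1(a) can fail. The span of X \ X_s is taken on its closure. *)

(* Defs.v *)
From HB Require Import structures.
From mathcomp Require Import all_boot all_order all_algebra.
From mathcomp Require Import all_classical all_reals all_analysis.

Set Implicit Arguments.
Unset Strict Implicit.
Unset Printing Implicit Defensive.

Import Order.TTheory GRing.Theory Num.Theory.
Import numFieldNormedType.Exports.

Local Open Scope classical_set_scope.
Local Open Scope ring_scope.

(* Functions from R>=0 to R>=0 are total functions R -> R of which only the
   values on `[0, +oo[ are constrained or used. *)
Definition Kinf (R : realType) (f : R -> R) : Prop :=
  [/\ {within `[0, +oo[, continuous f},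
      f 0 = 0,
      (forall s t, 0 <= s -> s < t -> f s < f t)
    & (forall M, exists2 s, 0 <= s & M < f s)].

(* Inverse of f : R>=0 -> R>=0. Outside the image of f, in particular at
   negative arguments when f is in K_infinity, the value is 0, so no eta > 0
   is below it. *)
Definition inv_nneg (R : realType) (f : R -> R) : R -> R :=
  'pinv_(fun=> 0) `[0, +oo[ f.

(* A box is the pair of its lower and upper corners. *)
Definition box (R : realType) n (b : 'rV[R]_n * 'rV[R]_n) : set 'rV[R]_n :=
  [set x | forall i, b.1 ord0 i <= x ord0 i <= b.2 ord0 i].

Definition box_decomposition (R : realType) n (S : set 'rV[R]_n)
    (B : seq ('rV[R]_n * 'rV[R]_n)) : Prop :=
  (forall b, b \in B -> forall i, b.1 ord0 i < b.2 ord0 i) /\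
  S = \bigcup_(b in [set` B]) box b.

(* The span is an attribute of a decomposition into boxes rather than of the
   underlying set; it is +oo for the decomposition of the empty set into no
   box. *)
Definition span (R : realType) n (B : seq ('rV[R]_n * 'rV[R]_n)) : \bar R :=
  \big[Order.min/+oo%E]_(b <- B)
    \big[Order.min/+oo%E]_(i < n) (`|b.2 ord0 i - b.1 ord0 i|%:E).

(* S is a finite union of boxes and eta <= span S. *)
Definition quantizable (R : realType) n (S : set 'rV[R]_n) (eta : R) : Prop :=
  exists2 B, box_decomposition S B & (eta%:E <= span B)%E.

Definition grid (R : realType) n (S : set 'rV[R]_n) (eta : R) : set 'rV[R]_n :=
  [set a | S a /\ forall i, exists k : int, a ord0 i = k%:~R * eta].

Definition product_set (R : realType) N (q : 'I_N -> nat)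
    (S : forall i, set 'rV[R]_(q i)) : set 'rV[R]_(\sum_i q i) :=
  [set w | forall i, S i (submxrow w i)].

Definition product_grid (R : realType) N (q : 'I_N -> nat)
    (S : forall i, set 'rV[R]_(q i)) (phi : 'rV[R]_N) :
    set 'rV[R]_(\sum_i q i) :=
  product_set (fun i => grid (S i) (phi ord0 i)).

(* phi is a positive vector and 0 < |phi| <= span (prod_i S i), where
   prod_i S i is decomposed into the products of the boxes of its factors, so
   that its span is the least span of a factor. *)
Definition product_quantizable (R : realType) N (q : 'I_N -> nat)
    (S : forall i, set 'rV[R]_(q i)) (phi : 'rV[R]_N) : Prop :=
  [/\ forall i, 0 < phi ord0 i, 0 < `|phi| &
      exists2 B : forall i, seq ('rV[R]_(q i) * 'rV[R]_(q i)),
        (forall i, box_decomposition (S i) (B i)) &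
        (`|phi|%:E <= \big[Order.min/+oo%E]_i span (B i))%E].

(* Deterministic discrete-time switched systems with m modes: each f_p is a
   single-valued map from X x W to X. *)
Record switched_system (R : realType) (n q r m : nat) := SwitchedSystem {
  sw_state : set 'rV[R]_n;
  sw_init : set 'rV[R]_n;
  sw_secret : set 'rV[R]_n;
  sw_input : set 'rV[R]_q;
  sw_dyn : 'I_m -> 'rV[R]_n -> 'rV[R]_q -> 'rV[R]_n;
  sw_output : set 'rV[R]_r;
  sw_out : 'rV[R]_n -> 'rV[R]_r;
  sw_init_sub : sw_init `<=` sw_state;
  sw_secret_sub : sw_secret `<=` sw_state;
  sw_dynP : forall p x w,
    sw_state x -> sw_input w -> sw_state (sw_dyn p x w);
  sw_outP : forall x, sw_state x -> sw_output (sw_out x)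
}.

Definition sw_infinite (R : realType) n q r m
    (Sys : switched_system R n q r m) : Prop :=
  ~ (finite_set (sw_state Sys) /\ finite_set (sw_input Sys)).

Definition sw_nonblocking (R : realType) n q r m
    (Sys : switched_system R n q r m) : Prop :=
  forall x, sw_state Sys x ->
    exists p w, sw_input Sys w /\ sw_state Sys (sw_dyn Sys p x w).

(* The difference X \ X_s of finite unions of closed boxes is a finite union of
   boxes some of whose faces may be missing. Its span is that of its closure,
   which coincides with the difference when the latter is a finite union of
   closed boxes. *)
Definition state_quantization (R : realType) n q r m
    (Sys : switched_system R n q r m) (eta : R) : Prop :=
  [/\ 0 < eta, quantizable (sw_secret Sys) eta &
      quantizable (closure (sw_state Sys `\` sw_secret Sys)) eta].

Definition delta_ISS (R : realType) n q r m (Sys : switched_system R n q r m)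
    (p : 'I_m) (V : 'rV[R]_n -> 'rV[R]_n -> R) (al au rho : R -> R)
    (kappa : R) : Prop :=
  [/\ Kinf al, Kinf au, Kinf rho, 0 < kappa < 1 &
    forall x x' w w', sw_state Sys x -> sw_state Sys x' ->
      sw_input Sys w -> sw_input Sys w' ->
      [/\ 0 <= V x x', al `|x - x'| <= V x x', V x x' <= au `|x - x'| &
          V (sw_dyn Sys p x w) (sw_dyn Sys p x' w')
            <= kappa * V x x' + rho `|w - w'|]].

Record transition_system (Q U W Y : Type) := TransitionSystem {
  ts_state : set Q;
  ts_init : set Q;
  ts_secret : set Q;
  ts_ext : set U;
  ts_int : set W;
  ts_trans : Q -> U -> W -> set Q;
  ts_output : set Y;
  ts_out : Q -> Y
}.

Definition ts_carrier (R : realType) (n m kd : nat) : Type :=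
  ('rV[R]_n * 'I_m * 'I_kd)%type.

Definition dwell_step (m kd : nat) (p : 'I_m) (l : 'I_kd) (p' : 'I_m)
    (l' : 'I_kd) : Prop :=
  [\/ [/\ (l < kd.-1)%N, p' = p & l' = l.+1 :> nat],
      [/\ l = kd.-1 :> nat, p' = p & l' = kd.-1 :> nat]
    | [/\ l = kd.-1 :> nat, p' <> p & l' = 0%N :> nat]].

Definition associated_ts (R : realType) n q r m
    (Sys : switched_system R n q r m) (kd : nat) :
    transition_system (ts_carrier R n m kd) 'I_m 'rV[R]_q 'rV[R]_r :=
  {| ts_state := [set z : ts_carrier R n m kd | sw_state Sys z.1.1];
     ts_init := [set z : ts_carrier R n m kd |
       sw_init Sys z.1.1 /\ z.2 = 0%N :> nat];
     ts_secret := [set z : ts_carrier R n m kd | sw_secret Sys z.1.1];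
     ts_ext := setT;
     ts_int := sw_input Sys;
     ts_trans := fun z u w => [set z' : ts_carrier R n m kd |
       [/\ sw_state Sys z'.1.1, z'.1.1 = sw_dyn Sys z.1.2 z.1.1 w,
           u = z.1.2 & dwell_step z.1.2 z.2 z'.1.2 z'.2]];
     ts_output := sw_output Sys;
     ts_out := fun z => sw_out Sys z.1.1 |}.

Definition finite_abstraction (R : realType) n r m N (q : 'I_N -> nat)
    (Sys : switched_system R n (\sum_i q i) r m) (kd : nat) (eta : R)
    (W : forall i, set 'rV[R]_(q i)) (phi : 'rV[R]_N) :
    transition_system (ts_carrier R n m kd) 'I_m 'rV[R]_(\sum_i q i)
      'rV[R]_r :=
  {| ts_state := [set z : ts_carrier R n m kd | grid (sw_state Sys) eta z.1.1];
     ts_init := [set z : ts_carrier R n m kd |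
       grid (sw_init Sys) eta z.1.1 /\ z.2 = 0%N :> nat];
     ts_secret := [set z : ts_carrier R n m kd | grid (sw_secret Sys) eta z.1.1];
     ts_ext := setT;
     ts_int := product_grid W phi;
     ts_trans := fun z u w => [set z' : ts_carrier R n m kd |
       [/\ grid (sw_state Sys) eta z'.1.1,
           `|sw_dyn Sys z.1.2 z.1.1 w - z'.1.1| <= eta,
           u = z.1.2 & dwell_step z.1.2 z.2 z'.1.2 z'.2]];
     ts_output := [set sw_out Sys z.1.1 | z in
       [set z : ts_carrier R n m kd | grid (sw_state Sys) eta z.1.1]];
     ts_out := fun z => sw_out Sys z.1.1 |}.

(* Local eps-InitSOPSF with constant theta, for a function S that is defined
   only on the pairs in dom: every quantification over pairs, universal or
   existential, is relativized to dom. *)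
Definition local_InitSOPSF (R : realType) (Q Q' U U' : Type) (q r : nat)
    (T : transition_system Q U 'rV[R]_q 'rV[R]_r)
    (T' : transition_system Q' U' 'rV[R]_q 'rV[R]_r)
    (dom : Q -> Q' -> Prop) (S : Q -> Q' -> R) (eps theta : R) : Prop :=
  (forall z z', ts_state T z -> ts_state T' z' -> dom z z' -> 0 <= S z z') /\
  0 <= theta /\
  exists2 alpha : R -> R, Kinf alpha &
  [/\ forall z, ts_init T z -> ts_secret T z ->
        exists z', [/\ ts_init T' z', ts_secret T' z', dom z z' &
                       S z z' <= eps],
      forall z', ts_init T' z' -> ~ ts_secret T' z' ->
        exists z, [/\ ts_init T z, ~ ts_secret T z, dom z z' &
                      S z z' <= eps],
      forall z z', ts_state T z -> ts_state T' z' -> dom z z' ->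
        alpha `|ts_out T z - ts_out T' z'| <= S z z' &
      forall z z' w w', ts_state T z -> ts_state T' z' -> dom z z' ->
        S z z' <= eps -> ts_int T w -> ts_int T' w' -> `|w - w'| <= theta ->
        (forall u zp, ts_ext T u -> ts_trans T z u w zp ->
           exists u' zp', [/\ ts_ext T' u', ts_trans T' z' u' w' zp',
                              dom zp zp' & S zp zp' <= eps]) /\
        (forall u' zp', ts_ext T' u' -> ts_trans T' z' u' w' zp' ->
           exists u zp, [/\ ts_ext T u, ts_trans T z u w zp,
                            dom zp zp' & S zp zp' <= eps])].

Definition same_mode (R : realType) n m kd (z z' : ts_carrier R n m kd) :
    Prop :=
  z.1.2 = z'.1.2 /\ z.2 = z'.2.

(* Meaningful on pairs related by same_mode only. *)
Definition opacity_V (R : realType) n m kd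
    (V : 'I_m -> 'rV[R]_n -> 'rV[R]_n -> R) (kappa : 'I_m -> R) (epsilon : R)
    (z z' : ts_carrier R n m kd) : R :=
  V z.1.2 z.1.1 z'.1.1 * kappa z.1.2 `^ (- ((z.2 : nat)%:R / epsilon)).

(* The maxima over modes below are of nonnegative quantities, hence the base
   value 0. *)
Definition kappa_max (R : realType) m (kappa : 'I_m -> R) (epsilon : R) : R :=
  \big[Order.max/0]_(p < m) (kappa p `^ ((epsilon - 1) / epsilon)).

Definition weighted_max (R : realType) m (kd : nat) (kappa : 'I_m -> R)
    (epsilon : R) (f : 'I_m -> R -> R) (s : R) : R :=
  \big[Order.max/0]_(p < m) (kappa p `^ (- (kd%:R / epsilon)) * f p s).

Definition fun_max (R : realType) m (f : 'I_m -> R -> R) (s : R) : R :=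
  \big[Order.max/0]_(p < m) f p s.

(* Main.v *)
(* The weight [kappa_p ^ (- l / epsilon)] absorbs mode switches. One step in
   mode p contracts V_p by kappa_p; incrementing the counter l gives back only
   kappa_p ^ (- 1 / epsilon), so the weighted function still contracts by
   kappa < 1, up to rho(theta) for the input mismatch and gammahat(eta) for the
   state rounding, and the bound on eta makes the level eps invariant. At a
   switch, replacing V_p by V_p' costs mu, which the dwell time condition bounds
   by the weight kappa_p ^ (- (kd - 1) / epsilon) released by resetting l.
   Every state has a grid point within eta, because the secret set and the
   closure of its complement are unions of boxes of sides at least eta. Outputs
   are compared through (min_p alpha_p) o ell^-1. *)

Require Import Defs.
From HB Require Import structures.
From mathcomp Require Import all_boot all_order all_algebra.
From mathcomp Require Import all_classical all_reals all_analysis.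
From mathcomp Require Import ring lra.

Set Implicit Arguments.
Unset Strict Implicit.
Unset Printing Implicit Defensive.

Import Order.TTheory GRing.Theory Num.Theory.
Import numFieldNormedType.Exports.

Local Open Scope classical_set_scope.
Local Open Scope ring_scope.

(** * Comparison functions of class [Kinf]: inverses, composition, minima *)

Section comparison_functions.
Variable R : realType.
Implicit Types f g : R -> R.

Lemma Kinf_le f s t : Kinf f -> 0 <= s -> s <= t -> f s <= f t.
Proof.
move=> [_ _ f_lt _] s0; rewrite le_eqVlt => /predU1P[->//|st].
exact/ltW/f_lt.
Qed.

Lemma Kinf_ge0 f s : Kinf f -> 0 <= s -> 0 <= f s.
Proof. by move=> Kf s0; have [_ <- _ _] := Kf; exact: Kinf_le. Qed.

Lemma Kinf_le_reflect f s t : Kinf f -> 0 <= t -> f s <= f t -> s <= t.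
Proof.
by move=> [_ _ f_lt _] t0; apply: contraTT; rewrite -!ltNge; exact: f_lt.
Qed.

Lemma Kinf_surj f t : Kinf f -> 0 <= t -> exists2 s, 0 <= s & f s = t.
Proof.
move=> Kf t0; have [f_cont f0 _ f_unb] := Kf.
have [M M0 /ltW tM] := f_unb t.
have [||s] := @IVT R f 0 M t M0.
- apply: continuous_subspaceW f_cont => x /=.
  by rewrite !in_itv/= => /andP[-> _].
- by rewrite f0 ge_min t0/= le_max tM orbT.
by rewrite in_itv/= => /andP[s0 _] <-; exists s.
Qed.

(** Continuity of the inverse comes from monotonicity alone: comparing [g x] with [g t + e] or
    [g t - e] amounts to comparing [x] with the value of [f] there. *)
Lemma Kinf_inverse f : Kinf f ->
  exists2 g, Kinf g & forall s, 0 <= s -> g (f s) = s.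
Proof.
move=> Kf; have [f_cont f0 f_lt _] := Kf.
have /choice[g gP] : forall t, exists s, 0 <= t -> 0 <= s /\ f s = t.
  move=> t; have [t0|_] := leP 0 t; last by exists 0.
  by have [s s0 fs] := Kinf_surj Kf t0; exists s.
have g_ge0 t : 0 <= t -> 0 <= g t by move/gP => [].
have gK t : 0 <= t -> f (g t) = t by move/gP => [].
have fK s : 0 <= s -> g (f s) = s.
  move=> s0; have fs0 := Kinf_ge0 Kf s0.
  by apply/le_anti/andP; split; apply: (Kinf_le_reflect Kf);
    rewrite ?g_ge0 ?gK.
exists g => //; split => //.
- apply/subspace_continuousP => t /=; rewrite in_itv/= andbT => t0.
  apply/cvgrPdist_lt => e e0.
  have ub : \forall x \near t, x < f (g t + e).
    by apply: lt_nbhsl; rewrite -{1}(gK t)// f_lt ?g_ge0// ltrDl.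
  have lb : \forall x \near t, 0 <= x -> g t - e < g x.
    (* Below zero [f] is unconstrained, but there [0 <= g x] already suffices. *)
    have [gte|gte] := ltP (g t - e) 0.
      by apply: filterE => x /g_ge0; exact: lt_le_trans.
    have : f (g t - e) < t by rewrite -{2}(gK t)// f_lt// ltrBlDr ltrDl.
    move/lt_nbhsr; apply: filterS => x ltx x0.
    by rewrite ltNge; apply: contraTN ltx => /(Kinf_le Kf (g_ge0 _ x0));
      rewrite gK// -leNgt.
  rewrite near_withinE; near=> x => /=; rewrite in_itv/= andbT => x0.
  rewrite ltr_distlC; apply/andP; split; first by move: x0; near: x.
  rewrite ltNge; apply/negP => /(Kinf_le Kf).
  rewrite gK// => /(_ (addr_ge0 (g_ge0 _ t0) (ltW e0))); apply/negP.
  by rewrite -ltNge; near: x.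
- by rewrite -[in LHS]f0 fK.
- move=> s t s0 st; rewrite ltNge; apply/negP => gts.
  have t0 := le_trans s0 (ltW st).
  by have := Kinf_le Kf (g_ge0 _ t0) gts; rewrite !gK// leNgt st.
- move=> M; exists (f (Num.max M 0 + 1)).
    by apply: (Kinf_ge0 Kf); rewrite addr_ge0// le_max lexx orbT.
  rewrite fK; last by rewrite addr_ge0// le_max lexx orbT.
  by rewrite (@le_lt_trans _ _ (Num.max M 0)) ?le_max ?lexx// ltrDl.
Unshelve. all: by end_near. Qed.

Lemma Kinf_comp f g : Kinf f -> Kinf g -> Kinf (f \o g).
Proof.
move=> Kf Kg; have [f_cont f0 f_lt f_unb] := Kf.
have [g_cont g0 g_lt _] := Kg; split => /=.
- apply/subspace_continuousP => t t0.
  have /subspace_continuousP/(_ (g t)) := f_cont.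
  have /subspace_continuousP/(_ t t0) gt := g_cont.
  move: (t0); rewrite /= !in_itv/= !andbT => t0'.
  move=> /(_ (Kinf_ge0 Kg t0')) ft; apply: cvg_comp ft => A /= gtA.
  have {gtA} : \forall x \near t, x \in `[0, +oo[ -> g x \in `[0, +oo[ -> A (g x).
    exact: (gt _ gtA).
  apply: filterS => x /= gxA x0; apply: gxA => //.
  by move: x0; rewrite !in_itv/= !andbT; exact: Kinf_ge0.
- by rewrite g0 f0.
- by move=> s t s0 st; rewrite f_lt ?g_lt// Kinf_ge0.
- move=> M; have [s s0 Ms] := f_unb M; have [t t0 gt] := Kinf_surj Kg s0.
  by exists t; rewrite ?gt.
Qed.

Lemma Kinf_min f g : Kinf f -> Kinf g -> Kinf (f \min g).
Proof.
move=> Kf Kg; have [f_cont f0 f_lt f_unb] := Kf.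
have [g_cont g0 g_lt g_unb] := Kg; split => /=.
- by move=> t; apply: continuous_min; [exact: f_cont|exact: g_cont].
- by rewrite f0 g0 minxx.
- by move=> s t s0 st; rewrite lt_min !gt_min f_lt// g_lt// orbT.
- move=> M; have [s s0 Ms] := f_unb M; have [t t0 Mt] := g_unb M.
  exists (Num.max s t); first by rewrite le_max s0.
  rewrite lt_min (lt_le_trans Ms) ?(lt_le_trans Mt)// Kinf_le// le_max lexx//.
  by rewrite orbT.
Qed.

Lemma Kinf_id : Kinf (@idfun R).
Proof.
split => //; first by apply: continuous_subspaceT => x; exact: cvg_id.
move=> M; exists (Num.max M 0 + 1).
  by rewrite addr_ge0// le_max lexx orbT.
by rewrite /= (@le_lt_trans _ _ (Num.max M 0)) ?le_max ?lexx// ltrDl.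
Qed.

(** The base value [s] keeps the minimum over an empty list in the class; a constant base would make
    the minimum bounded. *)
Lemma Kinf_bigmin (I : Type) (r : seq I) (f : I -> R -> R) :
  (forall i, Kinf (f i)) -> Kinf (fun s => \big[Num.min/s]_(i <- r) f i s).
Proof.
move=> Kf; elim: r => [|i r IHr].
  by under eq_fun do rewrite big_nil; exact: Kinf_id.
by under eq_fun do rewrite big_cons; exact: Kinf_min.
Qed.

End comparison_functions.

(** * Rounding points of unions of boxes to the grid *)

Section quantization.
Variables (R : realType) (n : nat).
Implicit Types (x y : 'rV[R]_n) (S : set 'rV[R]_n).

Lemma rV_norm_le x (e : R) :
  0 <= e -> (forall i, `|x ord0 i| <= e) -> `|x| <= e.
Proof.
move=> e0 xe; rewrite /Num.norm/= mx_normrE; apply: bigmax_le => //= -[i j] _.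
by rewrite (ord1 i).
Qed.

Lemma closed_box (b : 'rV[R]_n * 'rV[R]_n) : closed (box b).
Proof.
rewrite (_ : box b = \bigcap_(i in [set: 'I_n])
    (fun x : 'rV[R]_n => x ord0 i) @^-1` `[b.1 ord0 i, b.2 ord0 i]).
  apply: closed_bigI => i _; apply: preimage_closed; last exact: itv_closed.
  by move=> x _; exact: coord_continuous.
apply/seteqP; split => [x bx i _|x bx i]; first by rewrite /= in_itv/= bx.
by move: (bx i I); rewrite /= in_itv.
Qed.

Lemma box_decomposition_closed S B : box_decomposition S B -> closed S.
Proof.
move=> [_ ->]; apply: closed_bigcup; first exact: finite_seq.
by move=> b _; exact: closed_box.
Qed.

Lemma span_le_side B (b : 'rV[R]_n * 'rV[R]_n) i : b \in B ->
  (Defs.span B <= `|b.2 ord0 i - b.1 ord0 i|%:E)%E.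
Proof.
move=> bB; apply: le_trans (ge_bigmin_seq _ _ predT _ bB isT) _.
exact: bigmin_le.
Qed.

(** The multiple just below [a] serves unless it falls short of [c]; then the next one exceeds [a]
    and, the interval having length at least [eta], does not pass [d]. *)
Lemma itv_multiple (c d a eta : R) : 0 < eta -> eta <= d - c -> c <= a <= d ->
  exists k : int, c <= k%:~R * eta <= d /\ `|a - k%:~R * eta| <= eta.
Proof.
move=> eta0 cd /andP[ca ad].
have /andP[] := floor_itv (a / eta).
set k := Num.floor _; rewrite ler_pdivlMr// ltr_pdivrMr// intrD mulrDl mul1r.
move=> ka ak; have [ck|kc] := leP c (k%:~R * eta).
  exists k; rewrite ck (le_trans ka ad); split=> //.
  by rewrite ger0_norm ?subr_ge0// lerBlDl ltW.
exists (k + 1); rewrite intrD mulrDl mul1r; split; first by apply/andP; lra.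
by rewrite ler0_norm ?subr_le0 ?ltW//; lra.
Qed.

(** Each coordinate is rounded inside the box containing [x], so the result stays in [S]; in the
    infinity norm the errors do not add up. *)
Lemma grid_approx S eta x : 0 < eta -> quantizable S eta -> S x ->
  exists2 a, grid S eta a & `|x - a| <= eta.
Proof.
move=> eta0 [B [B_nd defS] eta_span]; rewrite {1}defS => -[b /= bB xb].
have coord i : exists k : int, b.1 ord0 i <= k%:~R * eta <= b.2 ord0 i /\
    `|x ord0 i - k%:~R * eta| <= eta.
  apply: itv_multiple => //.
  have := le_trans eta_span (span_le_side i bB).
  by rewrite lee_fin ger0_norm// subr_ge0 ltW// B_nd.
have [k kP] := choice coord.
exists (\row_i ((k i)%:~R * eta)).
  split; last by move=> i; exists (k i); rewrite mxE.
  by rewrite defS; exists b => //= i; rewrite mxE; exact: (kP i).1.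
apply: rV_norm_le; first exact: ltW.
by move=> i; rewrite !mxE; exact: (kP i).2.
Qed.

End quantization.

(* The difference of the state set and the secret set need not be closed, but
   its closure stays in the state set, which is. *)
Lemma grid_state_approx (R : realType) n q r m
    (Sys : switched_system R n q r m) eta x :
  (exists B, box_decomposition (sw_state Sys) B) ->
  state_quantization Sys eta -> sw_state Sys x ->
  exists2 a, grid (sw_state Sys) eta a & `|x - a| <= eta.
Proof.
move=> [B XB] [eta0 qs qns] Xx.
have [xs|xns] := pselect (sw_secret Sys x).
  have [a [sa ka] xa] := grid_approx eta0 qs xs.
  by exists a => //; split => //; exact: sw_secret_sub.
have cx : closure (sw_state Sys `\` sw_secret Sys) x.
  exact: subset_closure.
have [a [ca ka] xa] := grid_approx eta0 qns cx.
exists a => //; split => //.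
apply: (box_decomposition_closed XB); apply: closureS ca.
exact: subDsetl.
Qed.

(** * From the bound on [eta] to bounds on gains at [eta] *)

Section inverse.
Variable R : realType.

(* The hypothesis [0 < eta] excludes the junk value [0] of [inv_nneg] outside
   the image of [f]. *)
Lemma le_inv_nneg (f : R -> R) c eta :
  (forall s t, 0 <= s -> s <= t -> f s <= f t) ->
  0 < eta -> eta <= inv_nneg f c -> f eta <= c.
Proof.
move=> f_le eta0 eta_inv; rewrite /inv_nneg in eta_inv.
have [cf|ncf] := pselect ((f @` `[0, +oo[) c).
  rewrite -(pinvK (fun=> 0) (mem_set cf)).
  by apply: f_le => //; exact: ltW.
suff inv0 : 'pinv_(fun=> 0) `[0, +oo[ f c = 0.
  by move: (lt_le_trans eta0 eta_inv); rewrite inv0 ltxx.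
rewrite /pinv_ /= splitV /=.
by rewrite /phant_oinv /oinv /=; case: pselect.
Qed.
End inverse.

(** * Maxima over the modes *)

Section maxima.
Variables (R : realType) (m : nat).

Lemma weighted_max_ge kd (kappa : 'I_m -> R) epsilon (f : 'I_m -> R -> R) p s :
  kappa p `^ (- (kd%:R / epsilon)) * f p s <= weighted_max kd kappa epsilon f s.
Proof. exact: (le_bigmax 0 (fun p => kappa p `^ _ * f p s)). Qed.

Lemma weighted_max_le kd (kappa : 'I_m -> R) epsilon (f : 'I_m -> R -> R) s t :
  (forall p, Kinf (f p)) -> 0 <= s -> s <= t ->
  weighted_max kd kappa epsilon f s <= weighted_max kd kappa epsilon f t.
Proof.
move=> Kf s0 st; apply: le_bigmax2 => p _.
by rewrite ler_wpM2l ?powR_ge0 ?Kinf_le.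
Qed.

Lemma fun_max_ge (f : 'I_m -> R -> R) p s : f p s <= fun_max f s.
Proof. exact: (le_bigmax 0 (f ^~ s)). Qed.

Lemma fun_max_le (f : 'I_m -> R -> R) s t :
  (forall p, Kinf (f p)) -> 0 <= s -> s <= t -> fun_max f s <= fun_max f t.
Proof. by move=> Kf s0 st; apply: le_bigmax2 => p _; exact: Kinf_le. Qed.

Lemma kappa_max_ge (kappa : 'I_m -> R) epsilon p :
  kappa p `^ ((epsilon - 1) / epsilon) <= kappa_max kappa epsilon.
Proof. exact: (le_bigmax 0 (fun p => kappa p `^ _)). Qed.

End maxima.

(** * Powers of the contraction rates and the dwell time *)

Section powers.
Variable R : realType.
Implicit Types (k e mu : R).

Lemma powR_contraction_ge1 k x : 0 < k < 1 -> 0 <= x -> 1 <= k `^ (- x).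
Proof.
move=> /andP[k0 k1] x0; rewrite -[X in X <= _](powRr0 k).
by apply: ger_powR; rewrite ?oppr_le0// k0 ltW.
Qed.

(** Taking logarithms makes the claim linear in the exponent. The [+ 1] in the dwell bound matches
    the counter, which saturates at [kd.-1]. *)
Lemma dwell_powR k e mu (kd : nat) : 0 < k < 1 -> 1 < e -> 1 <= mu ->
  (1 <= kd)%N -> e * (ln mu / ln (1 / k)) + 1 <= kd%:R ->
  mu <= k `^ (- (kd.-1%:R / e)).
Proof.
move=> k01 e1 mu1 kd1 h; have /andP[k0 k1] := k01.
have e0 : 0 < e by exact: lt_trans e1.
have lk : ln k < 0 by rewrite ln_lt0.
rewrite -ler_ln ?posrE ?powR_gt0//; last exact: lt_le_trans mu1.
rewrite ln_powR mulNr -mulrN.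
have lV : ln (1 / k) = - ln k by rewrite div1r lnV.
have : e * (ln mu / - ln k) <= kd.-1%:R.
  by move: h; rewrite lV -{1}(prednK kd1) -natr1 lerD2r.
rewrite mulrA ler_pdivrMr ?oppr_gt0// => h'.
by rewrite mulrAC ler_pdivlMr// mulrC.
Qed.

End powers.

(** * One-step estimates *)

Lemma delta_ISS_step (R : realType) n q r m (Sys : switched_system R n q r m)
    p V al au rho gamma kappa x x' y w w' :
  delta_ISS Sys p V al au rho kappa -> Kinf gamma ->
  (forall x y z, sw_state Sys x -> sw_state Sys y -> sw_state Sys z ->
     V x y <= V x z + gamma `|y - z|) ->
  sw_state Sys x -> sw_state Sys x' -> sw_state Sys y ->
  sw_input Sys w -> sw_input Sys w' ->
  forall theta eta, `|w - w'| <= theta -> `|sw_dyn Sys p x' w' - y| <= eta ->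
  V (sw_dyn Sys p x w) y <= kappa * V x x' + rho theta + gamma eta.
Proof.
move=> [_ _ Krho _ ISS] Kgamma Vgamma Xx Xx' Xy Ww Ww' theta eta ww' xy.
have [_ _ _ step] := ISS _ _ _ _ Xx Xx' Ww Ww'.
(* The intermediate point is the exact successor of [x']: contraction compares the two successors,
   and [gamma] pays for rounding to [y]. *)
apply: le_trans (Vgamma _ _ (sw_dyn Sys p x' w') _ _ _) _ => //;
  try exact: sw_dynP.
rewrite lerD//; last by rewrite Kinf_le// distrC.
by rewrite (le_trans step)// lerD2l Kinf_le.
Qed.

(* [l'] is [l + 1] when the dwell counter is incremented, and [l] when it is
   saturated or, because of a switch, reset. *)
Lemma weighted_step_le (R : realType) (k e eps V V' rt ge K RT GE : R)
    (kd l l' : nat) :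
  0 < k < 1 -> 1 < e -> (l < kd)%N -> (l' <= l.+1)%N -> 0 <= V ->
  0 <= rt -> 0 <= ge -> 0 <= eps ->
  V * k `^ (- (l%:R / e)) <= eps ->
  V' <= k * V + rt + ge ->
  k `^ ((e - 1) / e) <= K ->
  k `^ (- (kd%:R / e)) * rt <= RT -> k `^ (- (kd%:R / e)) * ge <= GE ->
  GE <= (1 - K) * eps - RT ->
  V' * k `^ (- (l'%:R / e)) <= eps.
Proof.
move=> k01 e1 lkd ll' V0 rt0 ge0 eps0 Veps V'le kK rtRT geGE small.
have /andP[k0 k1] := k01; have e0 : 0 < e by exact: lt_trans e1.
have l'kd : (l' <= kd)%N by exact: leq_trans ll' lkd.
have mono (i j : nat) : (i <= j)%N -> k `^ (- (i%:R / e)) <= k `^ (- (j%:R / e)).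
  move=> ij; apply: ger_powR; first by rewrite k0 ltW.
  by rewrite lerN2 ler_pM2r ?invr_gt0// ler_nat.
have kV : k * V * k `^ (- (l'%:R / e)) <= K * eps.
  apply: (@le_trans _ _ (k * V * k `^ (- (l.+1%:R / e)))).
    by rewrite ler_wpM2l ?mono// mulr_ge0// ltW.
  (* One contraction by [k] and one counter increment combine into [k * k ^ (- 1 / e)]. *)
  have -> : k * V * k `^ (- (l.+1%:R / e)) =
      k `^ ((e - 1) / e) * (V * k `^ (- (l%:R / e))).
    rewrite mulrCA mulrA [k * V]mulrC -!mulrA; congr (V * _).
    rewrite -{1}(powRr1 (ltW k0)) -!powRD ?(lt0r_neq0 k0) ?implybT//.
    congr (_ `^ _); rewrite -natr1; field; exact: lt0r_neq0.
  by apply: ler_pM; rewrite ?powR_ge0 ?mulr_ge0 ?powR_ge0.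
(* The error terms carry the weight at [l' <= kd], hence the exponent [kd] in the maxima. *)
have wle c : 0 <= c -> c * k `^ (- (l'%:R / e)) <= k `^ (- (kd%:R / e)) * c.
  by move=> c0; rewrite mulrC ler_wpM2r ?mono.
apply: (@le_trans _ _ ((k * V + rt + ge) * k `^ (- (l'%:R / e)))).
  by rewrite ler_wpM2r ?powR_ge0.
(* The three weighted terms are at most [K * eps], [RT] and [GE], whose sum is at most [eps]. *)
have := wle _ rt0; have := wle _ ge0; rewrite !mulrDl; lra.
Qed.

(* A switch resets the counter, which costs the factor [mu]; the dwell time
   makes it no more than the weight accumulated at the saturated counter. *)
Lemma dwell_step_opacity_V (R : realType) n m kd
    (V : 'I_m -> 'rV[R]_n -> 'rV[R]_n -> R) (kappa : 'I_m -> R) epsilon mu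
    (p p' : 'I_m) (l l' : 'I_kd) x y :
  0 < kappa p < 1 -> 1 < epsilon -> 1 <= mu ->
  epsilon * (ln mu / ln (1 / kappa p)) + 1 <= kd%:R ->
  0 <= V p x y -> V p' x y <= mu * V p x y ->
  dwell_step p l p' l' ->
  exists2 j : nat, (j <= l.+1)%N &
    V p' x y * kappa p' `^ (- ((l' : nat)%:R / epsilon))
      <= V p x y * kappa p `^ (- (j%:R / epsilon)).
Proof.
move=> k01 e1 mu1 dwell V0 Vmu.
have kd1 : (1 <= kd)%N by case: kd l {l' dwell} => [[]|].
case=> [[_ -> ->]|[-> -> ->]|[-> _ ->]].
- by exists l.+1.
- by exists kd.-1.
- exists kd.-1 => //; rewrite mul0r oppr0 powRr0 mulr1 (le_trans Vmu)// mulrC.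
  by rewrite ler_wpM2l// dwell_powR.
Qed.

Theorem theorem21 (R : realType) (n r m N : nat) (q : 'I_N -> nat)
  (Sys : switched_system R n (\sum_i q i) r m) (kd : nat)
  (W : forall i, set 'rV[R]_(q i))
  (V : 'I_m -> 'rV[R]_n -> 'rV[R]_n -> R)
  (al au rho gamma : 'I_m -> R -> R) (kappa : 'I_m -> R)
  (mu epsilon eps theta eta : R) (phi : 'rV[R]_N)
  (hinf : sw_infinite Sys)
  (hnb : sw_nonblocking Sys)
  (hkd : (1 <= kd)%N)
  (hX : exists B, box_decomposition (sw_state Sys) B)
  (hW : sw_input Sys = product_set W)
  (hh : exists2 ell : R -> R, Kinf ell &
     forall x y, sw_state Sys x -> sw_state Sys y ->
       `|sw_out Sys x - sw_out Sys y| <= ell `|x - y|)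
  (hISS : forall p, delta_ISS Sys p (V p) (al p) (au p) (rho p) (kappa p))
  (hmu : 1 <= mu)
  (hVmu : forall p p' x y, sw_state Sys x -> sw_state Sys y ->
     V p x y <= mu * V p' x y)
  (hgamma : forall p, Kinf (gamma p))
  (hVgamma : forall p x y z,
     sw_state Sys x -> sw_state Sys y -> sw_state Sys z ->
     V p x y <= V p x z + gamma p `|y - z|)
  (hepsilon : 1 < epsilon)
  (heps : 0 <= eps)
  (htheta : 0 <= theta)
  (hphi : product_quantizable W phi)
  (hquant : state_quantization Sys eta)
  (* [X_0 `&` X_s]_eta = [X_0]_eta `&` [X_s]_eta is a well-formed quantization *)
  (hquant_init : quantizable (sw_init Sys `&` sw_secret Sys) eta)
  (heta : eta <= Num.min
     (inv_nneg (weighted_max kd kappa epsilon gamma)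
        ((1 - kappa_max kappa epsilon) * eps
           - weighted_max kd kappa epsilon rho theta))
     (inv_nneg (fun_max au) eps))
  (hdwell : forall p,
     epsilon * (ln mu / ln (1 / kappa p)) + 1 <= kd%:R) :
  local_InitSOPSF (associated_ts Sys kd)
    (finite_abstraction Sys kd eta W phi)
    (@same_mode R n m kd) (opacity_V V kappa epsilon) eps theta.
Proof.
have [ell Kell hell] := hh.
have [ell' Kell' ellK] := Kinf_inverse Kell.
have k01 p : 0 < kappa p < 1 by have [] := hISS p.
have Kau p : Kinf (au p) by have [] := hISS p.
have Krho p : Kinf (rho p) by have [] := hISS p.
have Kal p : Kinf (al p) by have [] := hISS p.
have [eta0 _ _] := hquant.
move: heta; rewrite le_min => /andP[eta_le_inv_gamma eta_le_inv_au].
have eta_gamma := le_inv_nneg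
  (fun _ _ => weighted_max_le kd kappa epsilon hgamma) eta0 eta_le_inv_gamma.
have eta_au := le_inv_nneg (fun _ _ => fun_max_le Kau) eta0 eta_le_inv_au.
have VP p x y : sw_state Sys x -> sw_state Sys y ->
    [/\ 0 <= V p x y, al p `|x - y| <= V p x y & V p x y <= au p `|x - y|].
  (* The bounds of [delta_ISS] presuppose an input, which non-blocking provides. *)
  move=> Xx Xy; have [_ [w [Ww _]]] := hnb _ Xx.
  by have [_ _ _ _ /(_ _ _ _ _ Xx Xy Ww Ww)[]] := hISS p.
(* Both directions of the transition condition reduce to this invariance: [y] is any state within
   [eta] of the exact successor of [x']. *)
have step p p' (l l' : 'I_kd) x x' w w' y :
    sw_state Sys x -> sw_state Sys x' -> sw_state Sys y ->
    sw_input Sys w -> sw_input Sys w' -> `|w - w'| <= theta ->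
    V p x x' * kappa p `^ (- ((l : nat)%:R / epsilon)) <= eps ->
    `|sw_dyn Sys p x' w' - y| <= eta -> dwell_step p l p' l' ->
    V p' (sw_dyn Sys p x w) y * kappa p' `^ (- ((l' : nat)%:R / epsilon))
      <= eps.
  move=> Xx Xx' Xy Ww Ww' ww' Veps xy pl.
  have Xf : sw_state Sys (sw_dyn Sys p x w) by exact: sw_dynP.
  have [Vf0 _ _] := VP p _ _ Xf Xy.
  have [j jl /le_trans] := dwell_step_opacity_V (k01 p) hepsilon hmu (hdwell p)
    Vf0 (hVmu p' p _ _ Xf Xy) pl.
  apply; have [V0 _ _] := VP p _ _ Xx Xx'.
  apply: (weighted_step_le (k01 p) hepsilon (ltn_ord l) jl V0 _ _ heps Veps
    (delta_ISS_step (hISS p) (hgamma p) (hVgamma p) Xx Xx' Xy Ww Ww' ww' xy)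
    (kappa_max_ge kappa epsilon p) (weighted_max_ge kd kappa epsilon rho p theta)
    (weighted_max_ge kd kappa epsilon gamma p eta) eta_gamma).
    exact: Kinf_ge0.
  by apply: Kinf_ge0 => //; exact: ltW.
have Wgrid w : product_grid W phi w -> sw_input Sys w.
  by rewrite hW => + i => /(_ i) [].
split; [|split] => //.
  move=> [[x p] l] [[x' p'] l'] /= Xx [Xx' _] [/= ep el].
  by rewrite mulr_ge0 ?powR_ge0//; have [] := VP p x x' Xx Xx'.
pose a s := \big[Num.min/s]_(p <- index_enum 'I_m) al p s.
have Ka : Kinf a by exact: Kinf_bigmin.
exists (a \o ell'); first exact: Kinf_comp.
split.
- move=> [[x p] l] /= [x0 l0] xs.
  (* Rounding within the intersection keeps the point both initial and secret. The counter is zero,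
     so the weight is one and the bound [eta_au] suffices. *)
  have [x' [[x'0 x's] x'grid] xx'] := grid_approx eta0 hquant_init (conj x0 xs).
  exists (x', p, l); split => //; rewrite /opacity_V/= l0 mul0r oppr0 powRr0 mulr1.
  have [Xx Xx'] := (sw_secret_sub xs, sw_secret_sub x's).
  have [_ _ /le_trans] := VP p _ _ Xx Xx'; apply.
  apply: le_trans eta_au; apply: le_trans (fun_max_ge au p eta).
  exact: Kinf_le.
- move=> [[x p] l] /= [[x0 xgrid] l0] xns.
  (* A grid point is matched with itself, at value zero; being on the grid, it could be secret only
     as an abstract secret. *)
  exists (x, p, l); split => //=; first by move=> xs; apply: xns.
  rewrite /opacity_V/= l0 mul0r oppr0 powRr0 mulr1; have Xx := sw_init_sub x0.
  have [_ _ /le_trans] := VP p _ _ Xx Xx; apply.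
  by rewrite subrr normr0; have [_ -> _ _] := Kau p.
- move=> [[x p] l] [[x' p'] l'] /= Xx [Xx' _] [/= _ _].
  have [V0 Val _] := VP p _ _ Xx Xx'.
  rewrite /opacity_V/=; apply: (@le_trans _ _ (V p x x')); last first.
    rewrite ler_peMr// powR_contraction_ge1// divr_ge0// ltW//.
    exact: lt_trans hepsilon.
  apply: le_trans Val.
  apply: (@le_trans _ _ (a `|x - x'|)); last exact: bigmin_le.
  apply: (Kinf_le Ka); first exact: Kinf_ge0.
  by rewrite -[leRHS]ellK//; apply: (Kinf_le Kell') => //; exact: hell.
- move=> [[x p] l] [[x' p'] l'] w w' /= Xx [Xx' _] [/= <- <-] Veps Ww.
  move=> /Wgrid Ww' ww'; split.
  + move=> _ [[y p1] l1] _ /= [_ -> _ pl].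
    (* The abstract successor is the rounding of the exact successor of [x']; mode and counter are
       copied. *)
    have [y' gy' yy'] := grid_state_approx hX hquant (sw_dynP p Xx' Ww').
    exists p, (y', p1, l1); split => //.
    apply: (step _ _ _ _ _ _ _ _ _ Xx Xx' _ Ww Ww' ww' Veps yy' pl).
    by case: gy'.
  + move=> _ [[y' p1] l1] _ /= [[Xy' gy'] yy' _ pl].
    (* Determinism forces the state component; mode and counter follow the abstract move. *)
    exists p, (sw_dyn Sys p x w, p1, l1); split => //=.
      by split => //; exact: sw_dynP.
    exact: (step _ _ _ _ _ _ _ _ _ Xx Xx' Xy' Ww Ww' ww' Veps yy' pl).
Qed.
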